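(* Let $U_0,\ldots,U_{n-1}$ be $m\times m$ real matrices such that $\mathcal{T}(U)$ is a subgenerator, and let $\epsilon\in\mathbb{C}$. Then $$\|e^{\mathcal{T}(U)}-e^{\mathcal{C}_\epsilon(U)}\|_\infty\le e^{|\epsilon|\,\|L\|_\infty}-1 .$$ Moreover, if $\epsilon$ is a pure imaginary number, then $$\|e^{\mathcal{T}(U)}-\mathrm{Re}(e^{\mathcal{C}_\epsilon(U)})\|_\infty\le e^{|\epsilon|^2\,\|L\|_\infty^2}-1,$$ where $\mathrm{Re}(e^{\mathcal{C}_\epsilon(U)})$ is the (entrywise) real part of $e^{\mathcal{C}_\epsilon(U)}$.
   Context: For the block-vector $U=(U_i)_{i=0,\ldots,n-1}$ of $m\times m$ matrices: $\mathcal{T}(U)$ is the $n\times n$ block upper triangular block-Toeplitz matrix whose $(i,j)$ block is $U_{j-i}$ if $j\ge i$ and $0$ if $j<i$; $\mathcal{C}_\epsilon(U)$ is the block-$\epsilon$-circulant matrix whose $(i,j)$ block is $U_{j-i}$ if $j\ge i$ and $\epsilon U_{n+j-i}$ if $j<i$; $L$ is the $n\times n$ block strictly lower triangular matrix whose $(i,j)$ block is $U_{n+j-i}$ if $j<i$ and $0$ if $j\ge i$, so that $\mathcal{C}_\epsilon(U)=\mathcal{T}(U)+\epsilon L$. A subgenerator is a real square matrix whose off-diagonal entries are nonnegative, whose diagonal entries are negative, and whose row sums are all nonpositive. $\|\cdot\|_\infty$ is the matrix norm induced by the vector infinity norm. *)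

(* Defs.v *)
From HB Require Import structures.
From mathcomp Require Import all_boot all_order all_algebra.
From mathcomp Require Import all_classical all_reals all_analysis.
From mathcomp Require Import complex.

Set Implicit Arguments.
Unset Strict Implicit.
Unset Printing Implicit Defensive.

Import Order.TTheory GRing.Theory Num.Theory.
Import numFieldNormedType.Exports.

Local Open Scope ring_scope.
Local Open Scope classical_set_scope.
Local Open Scope complex_scope.

(* Used below at K := R[i], where the generic topology of a numFieldType is
   the one given by the complex modulus. *)
Definition expmx (K : numFieldType) (p : nat) (A : 'M[K]_p) : 'M[K]_p :=
  limn (series (fun k : nat => (k`!%:R)^-1 *: A ^+ k)).

Definition modC (R : realType) (z : R[i]) : R := ComplexField.Normc.normc z.

Definition toCmx (R : realType) (p q : nat) (A : 'M[R]_(p, q)) :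
    'M[R[i]]_(p, q) :=
  map_mx (fun x : R => x%:C) A.

Definition Remx (R : realType) (p q : nat) (A : 'M[R[i]]_(p, q)) :
    'M[R]_(p, q) :=
  map_mx (@complex.Re R) A.

Definition vnorm_inf (R : realType) (p : nat) (x : 'cV[R[i]]_p) : R :=
  \big[Num.max/0]_(i < p) modC (x i 0).

(* Operator norm induced by vnorm_inf. Real matrices are measured through
   toCmx; the real and complex operator norms of a real matrix agree, both
   being the maximal absolute row sum. *)
Definition mxnorm_inf (R : realType) (p : nat) (A : 'M[R[i]]_p) : R :=
  sup [set vnorm_inf (A *m x) | x in [set x : 'cV[R[i]]_p | vnorm_inf x <= 1]].

Definition subgenerator (R : realType) (p : nat) (A : 'M[R]_p) : Prop :=
  [/\ forall i j : 'I_p, i != j -> 0 <= A i j,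
      forall i : 'I_p, A i i < 0
    & forall i : 'I_p, \sum_(j < p) A i j <= 0].

(* In the three matrices below U`_k is nth 0 U k, and every index used is
   smaller than n. The subtractions are in nat and never truncate. *)
Definition btoep (R : realType) (m n : nat) (U : n.-tuple 'M[R]_m) :
    'M[R]_(\sum_(i < n) m) :=
  \mxblock_(i < n, j < n) (if (i <= j)%N then U`_(j - i)%N else 0).

Definition bcirc (R : realType) (m n : nat) (eps : R[i])
    (U : n.-tuple 'M[R]_m) : 'M[R[i]]_(\sum_(i < n) m) :=
  \mxblock_(i < n, j < n)
    (if (i <= j)%N then toCmx U`_(j - i)%N else eps *: toCmx U`_(n + j - i)%N).

Definition blow (R : realType) (m n : nat) (U : n.-tuple 'M[R]_m) :
    'M[R]_(\sum_(i < n) m) :=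
  \mxblock_(i < n, j < n) (if (j < i)%N then U`_(n + j - i)%N else 0).

(* Main.v *)
Require Import Defs.
From HB Require Import structures.
From mathcomp Require Import all_boot all_order all_algebra.
From mathcomp Require Import all_classical all_reals all_analysis.
From mathcomp Require Import complex.
From mathcomp Require Import ring.

Set Implicit Arguments.
Unset Strict Implicit.
Unset Printing Implicit Defensive.

(* Everything is compared through Euler's product exp A = lim (1 + A/k)^k,
   whose distance to the partial exponential sum of A is dominated by the same
   scalar quantity at a bound a of the norm of A.  For a subgenerator T and k
   large, P = 1 + T/k is nonnegative with row sums at most 1, so it has norm at
   most 1.  With F = eps L/k of norm f, expanding (P + F)^k gives
     |(P + F)^k - P^k| <= (1 + f)^k - 1 <= exp(k f) - 1.
   If F is purely imaginary then only even powers of F reach the real part, and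
   the even part c_k and odd part s_k of (1 + f)^k satisfy
     c_(k+1) = c_k + f s_k,   s_(k+1) = s_k + f c_k,
   so s_k <= k f c_k and c_k <= exp(k^2 f^2); here k f = |eps| |L|. *)

Import Order.TTheory GRing.Theory Num.Theory.
Import numFieldNormedType.Exports.

Local Open Scope ring_scope.

(** * The complex modulus *)

Section modulus.
Variable R : realType.
Implicit Types (z w : R[i]) (a : R).

Lemma modCD z w : modC (z + w) <= modC z + modC w.
Proof. exact: (@le_normcD R z w). Qed.

Lemma modCM z w : modC (z * w) = modC z * modC w.
Proof. exact: ComplexField.Normc.normcM. Qed.

Lemma modCN z : modC (- z) = modC z.
Proof. exact: (@normcN R z). Qed.

Lemma modC0 : modC (0 : R[i]) = 0.
Proof. exact: ComplexField.Normc.normc0. Qed.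

Lemma modC_ge0 z : 0 <= modC z.
Proof. by case: z => a b; exact: sqrtr_ge0. Qed.

Lemma modC_real a : modC (real_complex R a) = `|a|.
Proof. by rewrite /modC /= expr0n addr0 sqrtr_sqr. Qed.

Lemma modC_imag a : modC (Complex 0 a) = `|a|.
Proof. by rewrite /modC /= expr0n add0r sqrtr_sqr. Qed.

Lemma modC1 : modC (1 : R[i]) = 1.
Proof. exact: ComplexField.Normc.normc1. Qed.

Lemma modC_nat n : modC (n%:R : R[i]) = n%:R.
Proof. by have := @normcMn R 1 n; rewrite ComplexField.Normc.normc1. Qed.

Lemma modC_natV n : modC (n%:R^-1 : R[i]) = n%:R^-1.
Proof.
rewrite [LHS]ComplexField.Normc.normcV; congr (_^-1); exact: modC_nat.
Qed.

Lemma normr_Re_le_modC z : `|complex.Re z| <= modC z.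
Proof. by rewrite -lecR; exact: normc_ge_Re. Qed.

Lemma normr_Im_le_modC z : `|complex.Im z| <= modC z.
Proof.
case: z => a b; rewrite /modC /= -sqrtr_sqr ler_wsqrtr// lerDr sqr_ge0 //.
Qed.

Lemma modC_le_ReIm z : modC z <= `|complex.Re z| + `|complex.Im z|.
Proof.
case: z => a b /=.
rewrite -modC_real -modC_imag (le_trans _ (modCD _ _))//.
by rewrite /GRing.add /= addr0 add0r.
Qed.

Lemma modC_sum (I : Type) (r : seq I) (P : pred I) (F : I -> R[i]) :
  modC (\sum_(i <- r | P i) F i) <= \sum_(i <- r | P i) modC (F i).
Proof.
elim/big_ind2 : _ => [|x1 x2 y1 y2 h1 h2|//]; first by rewrite modC0.
by rewrite (le_trans (modCD _ _))// lerD.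
Qed.

End modulus.

(** * The vector infinity norm and bounds on the induced operator norm *)

Section opbound.
Variables (R : realType) (p : nat).
Implicit Types (A B : 'M[R[i]]_p) (x y : 'cV[R[i]]_p) (c d : R).

Lemma vnorm_inf_ge0 x : 0 <= vnorm_inf x.
Proof.
by apply: (big_ind (fun t => 0 <= t)) => // *;
  rewrite ?modC_ge0// le_max; apply/orP; left.
Qed.

Lemma modC_le_vnorm x i : modC (x i 0) <= vnorm_inf x.
Proof. exact: (le_bigmax 0 (fun i => modC (x i 0))). Qed.

Lemma vnorm_inf_le x c :
  0 <= c -> (forall i, modC (x i 0) <= c) -> vnorm_inf x <= c.
Proof. by move=> c0 xc; exact: bigmax_le. Qed.

Lemma vnorm_infD x y : vnorm_inf (x + y) <= vnorm_inf x + vnorm_inf y.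
Proof.
apply: vnorm_inf_le => [|i]; first by rewrite addr_ge0 ?vnorm_inf_ge0.
by rewrite mxE (le_trans (modCD _ _))// lerD ?modC_le_vnorm.
Qed.

Lemma vnorm_inf0 : vnorm_inf (0 : 'cV[R[i]]_p) = 0.
Proof.
apply/eqP; rewrite eq_le vnorm_inf_ge0 andbT.
by apply: vnorm_inf_le => // i; rewrite mxE modC0.
Qed.

Lemma vnorm_infZ_le (a : R[i]) x :
  vnorm_inf (a *: x) <= modC a * vnorm_inf x.
Proof.
apply: vnorm_inf_le => [|i]; first by rewrite mulr_ge0 ?modC_ge0 ?vnorm_inf_ge0.
by rewrite mxE modCM ler_wpM2l ?modC_ge0 ?modC_le_vnorm.
Qed.

(** Working with upper bounds as a predicate lets sums, products and limits be handled without the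
    supremum; [mxnorm_inf_le] and [opbound_mxnorm] translate to and from [mxnorm_inf]. *)
Definition opbound A c := forall x, vnorm_inf (A *m x) <= c * vnorm_inf x.

Lemma opboundW A c d : c <= d -> opbound A c -> opbound A d.
Proof.
by move=> cd Ac x; rewrite (le_trans (Ac x))// ler_wpM2r// vnorm_inf_ge0.
Qed.

Lemma opboundD A B c d : opbound A c -> opbound B d -> opbound (A + B) (c + d).
Proof.
by move=> Ac Bd x; rewrite mulmxDl mulrDl (le_trans (vnorm_infD _ _))// lerD.
Qed.

Lemma opbound0 : opbound 0 0.
Proof. by move=> x; rewrite mul0mx vnorm_inf0 mul0r. Qed.

Lemma opbound1 : opbound 1 1.
Proof. by move=> x; rewrite -[1]/(1%:M) mul1mx mul1r. Qed.

Lemma opboundM A B c d : 0 <= c ->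
  opbound A c -> opbound B d -> opbound (A * B) (c * d).
Proof.
move=> c0 Ac Bd x; rewrite -[A * B]/(A *m B) -mulmxA (le_trans (Ac _))//.
by rewrite -mulrA ler_wpM2l.
Qed.

Lemma opboundX A c k : 0 <= c -> opbound A c -> opbound (A ^+ k) (c ^+ k).
Proof.
move=> c0 Ac; elim: k => [|k IHk]; first by rewrite !expr0; exact: opbound1.
by rewrite !exprS; exact: opboundM.
Qed.

Lemma opboundZ (a : R[i]) A c : opbound A c -> opbound (a *: A) (modC a * c).
Proof.
move=> Ac x; rewrite -scalemxAl (le_trans (vnorm_infZ_le _ _))// -mulrA.
by rewrite ler_wpM2l ?modC_ge0.
Qed.

Lemma opboundN A c : opbound A c -> opbound (- A) c.
Proof.
by move=> Ac; rewrite -scaleN1r -[c]mul1r -modC1 -modCN; exact: opboundZ.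
Qed.

Lemma opbound_sum (I : Type) (r : seq I) (F : I -> 'M[R[i]]_p) (c : I -> R) :
  (forall i, opbound (F i) (c i)) ->
  opbound (\sum_(i <- r) F i) (\sum_(i <- r) c i).
Proof.
by move=> Fc; elim/big_ind2 : _ => // *; [exact: opbound0|exact: opboundD].
Qed.

Lemma opbound_rows A c : 0 <= c ->
  (forall i, \sum_j modC (A i j) <= c) -> opbound A c.
Proof.
move=> c0 Ac x; apply: vnorm_inf_le => [|i].
  by rewrite mulr_ge0 ?vnorm_inf_ge0.
rewrite mxE (le_trans (modC_sum _ _ _))//.
apply: (@le_trans _ _ (\sum_j modC (A i j) * vnorm_inf x)).
  by apply: ler_sum => j _; rewrite modCM ler_wpM2l ?modC_ge0 ?modC_le_vnorm.
by rewrite -mulr_suml ler_wpM2r ?vnorm_inf_ge0.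
Qed.

(** The sum of all moduli dominates every row sum. This crude bound shows that the set defining
    [mxnorm_inf] is bounded, so that its [sup] is a true least upper bound. *)
Lemma opbound_exists A : exists2 c, 0 <= c & opbound A c.
Proof.
exists (\sum_i \sum_j modC (A i j)).
  by do 2 (apply: sumr_ge0 => ? _); exact: modC_ge0.
apply: opbound_rows => [|i].
  by do 2 (apply: sumr_ge0 => ? _); exact: modC_ge0.
rewrite [leRHS](bigD1 i)//= lerDl; apply: sumr_ge0 => k _.
by apply: sumr_ge0 => j _; exact: modC_ge0.
Qed.

(** Column [j] is the image of the [j]-th basis vector, which has norm 1. *)
Lemma opbound_coef A c i j : opbound A c -> modC (A i j) <= c.
Proof.
move=> Ac; have c0 : vnorm_inf (delta_mx j 0 : 'cV[R[i]]_p) = 1.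
  apply/eqP; rewrite eq_le; apply/andP; split.
    apply: vnorm_inf_le => // k; rewrite mxE andbT.
    by case: eqP => _; rewrite ?modC1 ?modC0.
  by rewrite (le_trans _ (modC_le_vnorm _ j))// mxE !eqxx modC1.
have := Ac (delta_mx j 0); rewrite c0 mulr1 -colE.
by apply: le_trans; rewrite (le_trans _ (modC_le_vnorm _ i))// mxE.
Qed.

Lemma mxnorm_inf_le A c : 0 <= c -> opbound A c -> mxnorm_inf A <= c.
Proof.
move=> c0 Ac; apply: ge_sup.
  by exists (vnorm_inf (A *m 0)); exists 0 => //=; rewrite vnorm_inf0 ler01.
move=> _ [x /= x1 <-]; rewrite (le_trans (Ac x))//.
by rewrite -[leRHS]mulr1 ler_wpM2l.
Qed.

(** A nonzero [x] is normalised into the unit ball, where the supremum applies. A vector of norm 0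
    has no normalisation; there the crude bound already gives 0. *)
Lemma opbound_mxnorm A : opbound A (mxnorm_inf A).
Proof.
move=> x; have [c c0 Ac] := opbound_exists A.
have [x0|x0] := eqVneq (vnorm_inf x) 0.
  by rewrite (le_trans (Ac x))// x0 !mulr0.
have xgt0 : 0 < vnorm_inf x by rewrite lt_def x0 vnorm_inf_ge0.
pose a := real_complex R (vnorm_inf x); pose y := a^-1 *: x.
have a0 : a != 0 by rewrite /a fmorph_eq0.
have ma : modC a = vnorm_inf x by rewrite modC_real ger0_norm// ltW.
have mV : modC a^-1 = (vnorm_inf x)^-1.
  by rewrite -ma; exact: ComplexField.Normc.normcV.
have y1 : vnorm_inf y <= 1.
  by rewrite (le_trans (vnorm_infZ_le _ _))// mV mulVf.
have Ay : vnorm_inf (A *m y) <= mxnorm_inf A.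
  apply: ub_le_sup; last by exists y.
  exists c => _ [z /= z1 <-]; rewrite (le_trans (Ac z))//.
  by rewrite -[leRHS]mulr1 ler_wpM2l.
have -> : x = a *: y by rewrite scalerA divff// scale1r.
rewrite -scalemxAr (le_trans (vnorm_infZ_le _ _))//.
rewrite ma mulrC; apply: (@le_trans _ _ (mxnorm_inf A * vnorm_inf x)).
  by rewrite ler_wpM2r// vnorm_inf_ge0.
by rewrite scalerA divff// scale1r.
Qed.

Lemma mxnorm_inf_ge0 A : 0 <= mxnorm_inf A.
Proof.
have [c c0 Ac] := opbound_exists A; apply: ub_le_sup.
  exists c => _ [z /= z1 <-]; rewrite (le_trans (Ac z))//.
  by rewrite -[leRHS]mulr1 ler_wpM2l.
by exists 0; rewrite /= ?mulmx0 vnorm_inf0.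
Qed.

End opbound.

(** * Limits of matrices, entry by entry *)

Section entrywise_limits.
Local Open Scope classical_set_scope.

Lemma mx_hausdorff (K : numFieldType) (m n : nat) :
  hausdorff_space 'M[K]_(m, n).
Proof.
move=> A B AB; apply/matrixP => i j; apply: (@norm_hausdorff K K) => X Y AX BY.
have [M [XM YM]] := AB _ _ (@coord_continuous K m n i j A X AX)
  (@coord_continuous K m n i j B Y BY).
by exists (M i j).
Qed.

(** A neighbourhood of [A] contains a product of neighbourhoods of its finitely many entries, and
    eventually all of them are entered at once. Separation of the matrix space then identifies
    [limn]. *)
Lemma limn_mx (K : numFieldType) (m n : nat) (M : nat -> 'M[K]_(m, n))
    (A : 'M[K]_(m, n)) :
  (forall i j (e : K), 0 < e -> \forall k \near \oo, `|A i j - M k i j| < e) ->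
  limn M = A.
Proof.
move=> MA; apply: (cvg_lim (@mx_hausdorff K m n)) => X [P AP PX].
near=> k; apply: PX.
near: k; apply: filter_forall => i; apply: filter_forall => j.
have : M k i j @[k --> \oo] --> A i j by apply/cvgrPdist_lt => e; exact: MA.
by apply; exact: AP.
Unshelve. all: by end_near. Qed.

(* R[i] carries no canonical topology under its own name, only as an abstract
   numFieldType, so limits are taken on the real-valued modulus. *)
Definition entrycvg (R : realType) (p : nat) (M : nat -> 'M[R[i]]_p)
    (A : 'M[R[i]]_p) :=
  forall i j, modC (M k i j - A i j) @[k --> \oo] --> (0 : R).

Variables (R : realType) (p : nat).
Implicit Types (M N : nat -> 'M[R[i]]_p) (A B : 'M[R[i]]_p) (u : nat -> R).

Lemma squeeze_cvg0 (v u : nat -> R) : (forall k, 0 <= v k <= u k) ->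
  u k @[k --> \oo] --> (0 : R) -> v k @[k --> \oo] --> (0 : R).
Proof.
move=> vu u0; apply: (squeeze_cvgr _ (cvg_cst (0 : R)) u0).
by apply: nearW => k /=; exact: vu.
Qed.

Lemma limn_entrycvg M A :
  entrycvg M A -> limn (M : nat -> 'M[_ : numFieldType]_p) = A.
Proof.
(* In the order of [R[i]], a positive [e] has zero imaginary part, so only its real part has to be
   compared with the modulus. *)
move=> MA; apply: limn_mx => i j e; rewrite ltcE => /andP[/= /eqP e0 egt0].
move/cvgrPdist_lt: (MA i j) => /(_ _ egt0); apply: filterS => k.
rewrite sub0r normrN ger0_norm ?modC_ge0// -modCN opprB => h.
by rewrite ltcE /= e0 eqxx.
Qed.

Lemma entrycvg_opbound M A u : entrycvg M A ->
  u k @[k --> \oo] --> (0 : R) ->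
  forall N, (forall k, opbound (N k - M k) (u k)) -> entrycvg N A.
Proof.
move=> MA u0 N NM i j.
apply: (@squeeze_cvg0 _ (fun k => u k + modC (M k i j - A i j))) => [k|].
  rewrite modC_ge0/= -[N k i j](subrK (M k i j)) -addrA.
  rewrite (le_trans (modCD _ _))// lerD//.
  by have := opbound_coef i j (NM k); rewrite !mxE.
by rewrite -[X in _ --> X](addr0 0); apply: cvgD u0 (MA i j).
Qed.

Lemma entrycvgB M N A B : entrycvg M A -> entrycvg N B ->
  entrycvg (fun k => M k - N k) (A - B).
Proof.
move=> MA NB i j.
apply: (@squeeze_cvg0 _ (fun k => modC (M k i j - A i j) + modC (N k i j - B i j))).
  move=> k; rewrite modC_ge0/= -[modC (N k i j - _)]modCN.
  rewrite (le_trans _ (modCD _ _))// !mxE le_eqVlt; apply/orP; left.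
  by apply/eqP; congr modC; ring.
by rewrite -[X in _ --> X](addr0 0); apply: cvgD (MA i j) (NB i j).
Qed.

(** The real part is additive and does not increase the modulus. *)
Lemma entrycvg_Re M A : entrycvg M A ->
  entrycvg (fun k => toCmx (Remx (M k))) (toCmx (Remx A)).
Proof.
move=> MA i j; apply: squeeze_cvg0 (MA i j) => k; rewrite modC_ge0/= !mxE.
rewrite -[_ - _]/(real_complex R (complex.Re (M k i j)) - real_complex R _).
rewrite -rmorphB modC_real -raddfB; exact: normr_Re_le_modC.
Qed.

Lemma cvg_sum0 (I : Type) (r : seq I) (v : nat -> I -> R) :
  (forall j, v k j @[k --> \oo] --> (0 : R)) ->
  \sum_(j <- r) v k j @[k --> \oo] --> (0 : R).
Proof.
move=> v0; elim: r => [|j r IHr].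
  by under eq_fun do rewrite big_nil; exact: cvg_cst.
have := cvgD (v0 j) IHr; rewrite addr0.
have -> : (fun k => \sum_(l <- j :: r) v k l) =
  (fun k => v k j + \sum_(l <- r) v k l) by apply/funext => k; rewrite big_cons.
exact.
Qed.

(** For fixed [x], a coordinate of [A *m x] differs from that of [M k *m x] by at most [d k], a
    finite combination of entrywise errors, which tends to 0. *)
Lemma opbound_lim M A c : 0 <= c -> entrycvg M A ->
  (\forall k \near \oo, opbound (M k) c) -> opbound A c.
Proof.
move=> c0 MA Mc x; apply: vnorm_inf_le => [|i].
  by rewrite mulr_ge0 ?vnorm_inf_ge0.
pose d k := \sum_j modC (M k i j - A i j) * modC (x j 0).
have d0 : d k @[k --> \oo] --> (0 : R).
  apply: cvg_sum0 => j; rewrite -[X in _ --> X](mul0r (modC (x j 0))).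
  by apply: cvgMr_tmp; exact: MA.
rewrite -[leRHS]addr0; apply: (@cvgr_to_ge _ \oo _ R
  (fun k => c * vnorm_inf x + d k)).
  by apply: cvgD d0; exact: cvg_cst.
apply: filterS Mc => k Mkc.
apply: (@le_trans _ _ (modC ((M k *m x) i 0) + d k)); last first.
  by rewrite lerD2r (le_trans _ (Mkc x))// modC_le_vnorm.
rewrite -[(A *m x) i 0](subrK ((M k *m x) i 0)) addrC.
rewrite (le_trans (modCD _ _))// lerD2l -modCN opprB.
rewrite !mxE -sumrB (le_trans (modC_sum _ _ _))//.
by apply: ler_sum => j _; rewrite -mulrBl modCM.
Qed.

End entrywise_limits.

(** * The matrix exponential as the limit of Euler's product *)

Section exponential.
Local Open Scope classical_set_scope.
Variable R : realType.

(** After inversion this is [1 - t <= expR (- t)] at [t = h / (1 + h)], since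
    [1 - t = 1 / (1 + h)]. *)
Lemma expR_div1D_le (h : R) : 0 <= h -> expR (h / (1 + h)) <= 1 + h.
Proof.
move=> h0; have h1 : 0 < 1 + h by rewrite ltr_pwDl.
rewrite -[leLHS]invrK -expRN -[leRHS]invrK lef_pV2 ?posrE ?invr_gt0 ?expR_gt0//.
apply: le_trans (expR_ge1Dx _); rewrite le_eqVlt; apply/orP; left.
by apply/eqP; field; rewrite gt_eqF.
Qed.

(** With [h = a / k.+1], the power lies between [expR (a / (1 + h))] and [expR a], and [h] tends to
    0. *)
Lemma cvg_expR_pow (a : R) : 0 <= a ->
  (1 + a / k.+1%:R) ^+ k.+1 @[k --> \oo] --> expR a.
Proof.
move=> a0; pose h k : R := a / k.+1%:R.
have h0 k : 0 <= h k by rewrite divr_ge0.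
have hk k : k.+1%:R * h k = a by rewrite /h mulrC divfK ?pnatr_eq0.
apply: (@squeeze_cvgr _ _ _ _ (fun k => expR (a / (1 + h k))) (cst (expR a))).
- apply: nearW => k /=; rewrite -/(h k).
  have -> : a / (1 + h k) = k.+1%:R * (h k / (1 + h k)) by rewrite mulrA hk.
  have -> : expR a = expR (k.+1%:R * h k) by rewrite hk.
  rewrite !expRM_natl !lerXn2r ?nnegrE ?expR_ge0 ?addr_ge0//.
    exact: expR_ge1Dx.
  exact: expR_div1D_le.
- apply: continuous_cvg; first exact: continuous_expR.
  rewrite -[X in _ --> X](divr1 a); apply: cvgMl_tmp; apply: cvgV => //.
  rewrite -[X in _ --> X](addr0 1); apply: cvgD; first exact: cvg_cst.
  rewrite -(mulr0 a); apply: cvgMl_tmp; exact: cvg_harmonic.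
- exact: cvg_cst.
Qed.

(* 'C(n, i) i! is a falling factorial of n with i factors, hence at most n ^ i. *)
Lemma exp_coeff_binomial_ge0 (k i : nat) :
  0 <= (i`!%:R)^-1 - 'C(k.+1, i)%:R / k.+1%:R ^+ i :> R.
Proof.
rewrite subr_ge0 ler_pdivrMr ?exprn_gt0// mulrC ler_pdivlMr ?ltr0n ?fact_gt0//.
rewrite -natrM bin_ffact -natrX ler_nat ffact_prod.
have -> : (k.+1 ^ i = \prod_(j < i) k.+1)%N by rewrite prod_nat_const card_ord.
by apply: leq_prod => j _; exact: leq_subr.
Qed.

Variable p : nat.
Implicit Types A : 'M[R[i]]_p.

Definition euler_mx A (k : nat) : 'M[R[i]]_p :=
  (1 + k.+1%:R^-1 *: A) ^+ k.+1.

Lemma scalemxX (a : R[i]) A k : (a *: A) ^+ k = a ^+ k *: A ^+ k.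
Proof.
elim: k => [|k IHk]; first by rewrite !expr0 scale1r.
rewrite !exprS IHk -[LHS]/((a *: A) *m (a ^+ k *: A ^+ k)).
by rewrite -scalemxAl -scalemxAr; exact: scalerA.
Qed.

(** The first [k.+2] terms of the series have degrees 0 to [k.+1], exactly those of the binomial
    expansion of the power, so the two match term by term. *)
Lemma series_sub_euler A (k : nat) :
  series (fun i => (i`!%:R)^-1 *: A ^+ i) k.+2 - euler_mx A k =
  \sum_(i < k.+2) real_complex R ((i`!%:R)^-1 - 'C(k.+1, i)%:R / k.+1%:R ^+ i)
    *: A ^+ i.
Proof.
rewrite /series /= big_mkord /euler_mx exprDn_comm; last exact: commr_sym (commr1 _).
rewrite -sumrB; apply: eq_bigr => i _.
rewrite expr1n mul1r scalemxX; apply/matrixP => u v.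
rewrite rmorphB rmorphM !fmorphV rmorphXn !rmorph_nat -exprVn.
rewrite !mxE mulmxnE mxE -mulr_natl; ring.
Qed.

(* The coefficients of the difference are nonnegative, so the scalar
   difference at a dominates the matrix one. *)
Lemma opbound_series_sub_euler A (a : R) (k : nat) : 0 <= a -> opbound A a ->
  opbound (series (fun i => (i`!%:R)^-1 *: A ^+ i) k.+2 - euler_mx A k)
    (series (exp_coeff a) k.+2 - (1 + a / k.+1%:R) ^+ k.+1).
Proof.
move=> a0 Aa; rewrite series_sub_euler.
have -> : series (exp_coeff a) k.+2 - (1 + a / k.+1%:R) ^+ k.+1 =
  \sum_(i < k.+2) ((i`!%:R)^-1 - 'C(k.+1, i)%:R / k.+1%:R ^+ i) * a ^+ i.
  rewrite /series /= big_mkord exprDn -sumrB; apply: eq_bigr => i _.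
  rewrite expr1n mul1r exprMn exprVn -mulr_natl /exp_coeff /=; ring.
apply: opbound_sum => i.
move: (exp_coeff_binomial_ge0 k i); move: (_ - _) => c c0.
rewrite -[X in opbound _ (X * _)](ger0_norm c0) -modC_real.
by apply: opboundZ; exact: opboundX.
Qed.

(** Real and imaginary parts converge absolutely by comparison with the exponential series at [a];
    [cv] treats both as additive maps dominated by the modulus. *)
Lemma cvg_series_modC (z : nat -> R[i]) (a : R) :
  (forall k, modC (z k) <= exp_coeff a k) -> 0 <= a ->
  exists l, modC (series z k - l) @[k --> \oo] --> (0 : R).
Proof.
move=> za a0.
have cv (f : {additive R[i] -> R}) : (forall z, `|f z| <= modC z) ->
    cvgn (series (f \o z)).
  move=> fz; apply: normed_cvg.
  apply: (series_le_cvg _ _ _ (is_cvg_series_exp_coeff a)) => k /=.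
  - exact: normr_ge0.
  - exact: exp_coeff_ge0.
  - exact: le_trans (fz _) (za k).
have cRe := cv (@complex.Re R) (@normr_Re_le_modC R).
have cIm := cv (@complex.Im R) (@normr_Im_le_modC R).
exists (Complex (limn (series (@complex.Re R \o z)))
  (limn (series (@complex.Im R \o z)))).
apply: (@squeeze_cvg0 _ _
  (fun k => `|series (@complex.Re R \o z) k - limn (series (@complex.Re R \o z))|
    + `|series (@complex.Im R \o z) k - limn (series (@complex.Im R \o z))|)).
  move=> k; rewrite modC_ge0/=.
  by rewrite (le_trans (modC_le_ReIm _))// !raddfB /= !raddf_sum.
rewrite -[X in _ --> X](addr0 0); apply: cvgD.
  by apply/norm_cvg0P/subr_cvg0.
by apply/norm_cvg0P/subr_cvg0.
Qed.

(** [expmx] is written with [limn], which says nothing about a divergent sequence; this lemma makes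
    it a genuine limit. The entries of [A ^+ k] are bounded by [a ^+ k]. *)
Lemma entrycvg_expmx A :
  entrycvg (series (fun k => (k`!%:R)^-1 *: A ^+ k)) (expmx A).
Proof.
have [a a0 Aa] := opbound_exists A.
pose z i j k : R[i] := (k`!%:R)^-1 * (A ^+ k) i j.
have zE i j k : series (fun k => (k`!%:R)^-1 *: A ^+ k) k i j = series (z i j) k.
  by rewrite /series /= summxE; apply: eq_bigr => l _; rewrite mxE.
have zl i j : exists l, modC (series (z i j) k - l) @[k --> \oo] --> (0 : R).
  apply: (cvg_series_modC _ a0) => k; rewrite modCM /exp_coeff /= mulrC.
  rewrite modC_natV.
  by rewrite ler_wpM2r ?invr_ge0// opbound_coef//; exact: opboundX.
(* The limits of the separate entries are collected into one matrix, which [limn_entrycvg]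
   identifies with [expmx A]. *)
have /choice[E EP] : forall ij, exists l,
    modC (series (z ij.1 ij.2) k - l) @[k --> \oo] --> (0 : R).
  by move=> [i j]; exact: zl.
suff SE : entrycvg (series (fun k => (k`!%:R)^-1 *: A ^+ k))
    (\matrix_(i, j) E (i, j)).
  by rewrite /expmx (limn_entrycvg SE).
move=> i j; rewrite mxE; under eq_fun do rewrite zE; exact: (EP (i, j)).
Qed.

(** Both terms of the scalar bound tend to [expR a], so the Euler products share the limit of the
    partial sums, taken along indices shifted by two. *)
Lemma entrycvg_euler A : entrycvg (euler_mx A) (expmx A).
Proof.
have [a a0 Aa] := opbound_exists A.
have S2 : entrycvg (fun k => series (fun k => (k`!%:R)^-1 *: A ^+ k) k.+2)
    (expmx A).
  move=> i j; have := @entrycvg_expmx A i j.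
  by rewrite -cvg_shiftS -cvg_shiftS.
apply: (entrycvg_opbound S2 (u := fun k =>
  series (exp_coeff a) k.+2 - (1 + a / k.+1%:R) ^+ k.+1)) => [|k].
  rewrite -[X in _ --> X](subrr (expR a)); apply: cvgB; last exact: cvg_expR_pow.
  have := is_cvg_series_exp_coeff a.
  by rewrite -cvg_shiftS -cvg_shiftS.
by rewrite -opprB; apply: opboundN; exact: opbound_series_sub_euler.
Qed.

End exponential.

(** * Perturbation of matrix powers *)

Section discrete_perturbation.
Variables (R : realType) (p : nat).
Implicit Types (P F Q : 'M[R[i]]_p) (f : R).

(** By induction: splitting off the last factor gives a recurrence for the matrix difference, and
    the scalar bound satisfies the same recurrence with 1 for [P] and [f] for [F]. *)
Lemma opbound_subX P F f k : 0 <= f -> opbound P 1 -> opbound F f ->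
  opbound ((P + F) ^+ k - P ^+ k) ((1 + f) ^+ k - 1).
Proof.
move=> f0 P1 Ff; elim: k => [|k IHk].
  by rewrite !expr0 !subrr; exact: opbound0.
have -> : (P + F) ^+ k.+1 - P ^+ k.+1 =
    ((P + F) ^+ k - P ^+ k) * (P + F) + P ^+ k * F.
  by rewrite !exprSr mulrBl mulrDr [P ^+ k * (P + F)]mulrDr opprD addrA subrK.
have -> : (1 + f) ^+ k.+1 - 1 = ((1 + f) ^+ k - 1) * (1 + f) + 1 ^+ k * f.
  by rewrite exprSr expr1n; ring.
apply: opboundD; apply: opboundM => //.
- by rewrite subr_ge0 exprn_ege1// lerDl.
- exact: opboundD.
- exact: opboundX.
Qed.

Definition Immx (A : 'M[R[i]]_p) : 'M[R]_p := map_mx (@complex.Im R) A.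

Lemma RemxM (A B : 'M[R[i]]_p) :
  Remx (A * B) = Remx A * Remx B - Immx A * Immx B.
Proof.
apply/matrixP => i j; rewrite !mxE raddf_sum -sumrB; apply: eq_bigr => l _.
by rewrite !mxE; case: (A i l) (B l j) => [a b] [c d].
Qed.

Lemma ImmxM (A B : 'M[R[i]]_p) :
  Immx (A * B) = Remx A * Immx B + Immx A * Remx B.
Proof.
apply/matrixP => i j; rewrite !mxE raddf_sum -big_split; apply: eq_bigr => l _.
by rewrite !mxE; case: (A i l) (B l j) => [a b] [c d].
Qed.

Lemma toCmxM (A B : 'M[R]_p) : toCmx (A * B) = toCmx A * toCmx B.
Proof. exact: (map_mxM (real_complex R)). Qed.

Lemma toCmxD (A B : 'M[R]_p) : toCmx (A + B) = toCmx A + toCmx B.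
Proof. exact: (map_mxD (real_complex R)). Qed.

Lemma toCmxB (A B : 'M[R]_p) : toCmx (A - B) = toCmx A - toCmx B.
Proof. exact: (map_mxB (real_complex R)). Qed.

Lemma toCmx1 : toCmx 1 = 1 :> 'M[R[i]]_p.
Proof. exact: (map_mx1 (real_complex R)). Qed.

Lemma Remx1 : Remx (1 : 'M[R[i]]_p) = 1.
Proof. by apply/matrixP => i j; rewrite !mxE; case: eqP. Qed.

Lemma Immx1 : Immx 1 = 0.
Proof. by apply/matrixP => i j; rewrite !mxE; case: eqP. Qed.

(** [Remx Q] acts as the unperturbed factor and [Immx Q] as the perturbation. Multiplication by [Q]
    mixes real and imaginary parts, so the induction bounds both together. *)
Lemma opbound_ReX Q f k : 0 <= f ->
  opbound (toCmx (Remx Q)) 1 -> opbound (toCmx (Immx Q)) f ->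
  opbound (toCmx (Remx Q) ^+ k - toCmx (Remx (Q ^+ k)))
    (expR ((k%:R * f) ^+ 2) - 1).
Proof.
move=> f0 Q1 Qf.
(* c and s are the even and odd parts of (1 + f) ^+ k. *)
suff [c [s [/andP[s0 sc] /andP[c1 ck] Dc Is]]] : exists c s : R,
    [/\ 0 <= s <= k%:R * f * c, 1 <= c <= expR ((k%:R * f) ^+ 2),
        opbound (toCmx (Remx Q) ^+ k - toCmx (Remx (Q ^+ k))) (c - 1) &
        opbound (toCmx (Immx (Q ^+ k))) s].
  by apply: opboundW Dc; rewrite lerD2r.
elim: k => [|k [c [s [/andP[s0 sc] /andP[c1 ck] Dc Is]]]].
  exists 1, 0; rewrite !expr0 !mul0r expr0n expR0 !lexx Remx1 Immx1 toCmx1.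
  rewrite !subrr (_ : toCmx 0 = 0); last exact: (map_mx0 (real_complex R)).
  by split=> //; exact: opbound0.
have c0 : 0 <= c by rewrite (le_trans ler01).
(* [Remx (Q ^+ k)] is within [c - 1] of a matrix of norm at most 1. *)
have Rc : opbound (toCmx (Remx (Q ^+ k))) c.
  rewrite -[c](subrK 1) -[toCmx _](subrK (toCmx (Remx Q) ^+ k)).
  apply: opboundD; first by rewrite -opprB; exact: opboundN.
  by have := opboundX k ler01 Q1; rewrite expr1n.
exists (c + s * f), (c * f + s); split.
- rewrite addr_ge0 ?mulr_ge0//=.
  apply: (@le_trans _ _ (c * f + k%:R * f * c)); first by rewrite lerD2l.
  apply: (@le_trans _ _ (k.+1%:R * f * c)); last first.
    by rewrite ler_wpM2l ?mulr_ge0// lerDl mulr_ge0.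
  by rewrite -natr1 le_eqVlt; apply/orP; left; apply/eqP; ring.
- apply/andP; split; first by rewrite (le_trans c1)// lerDl mulr_ge0.
  (* The bound on [s] gives the factor [1 + k f^2 <= exp (k f^2)]; in the exponent,
     [k^2 + k <= (k + 1)^2] closes the induction. *)
  apply: (@le_trans _ _ (c * (1 + k%:R * f ^+ 2))).
    rewrite mulrDr mulr1 lerD2l (le_trans (ler_wpM2r f0 sc))//.
    by rewrite le_eqVlt; apply/orP; left; apply/eqP; ring.
  apply: (@le_trans _ _ (expR ((k%:R * f) ^+ 2) * expR (k%:R * f ^+ 2))).
    apply: ler_pM => //; last exact: expR_ge1Dx.
    by rewrite addr_ge0// mulr_ge0// sqr_ge0.
  rewrite -expRD ler_expR -natr1 -subr_ge0.
  have -> : ((k%:R + 1) * f) ^+ 2 - ((k%:R * f) ^+ 2 + k%:R * f ^+ 2) =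
    (k%:R + 1) * f ^+ 2 by ring.
  by rewrite mulr_ge0 ?sqr_ge0// addr_ge0.
- rewrite !exprSr RemxM toCmxB !toCmxM.
  have -> : c + s * f - 1 = (c - 1) * 1 + s * f by ring.
  rewrite opprB addrCA addrC -mulrBl.
  apply: opboundD; apply: opboundM => //; by rewrite subr_ge0.
- rewrite exprSr ImmxM toCmxD !toCmxM.
  rewrite -[s]mulr1.
  by apply: opboundD; apply: opboundM.
Qed.

End discrete_perturbation.

(** * From powers to exponentials *)

Section exponential_perturbation.
Local Open Scope classical_set_scope.
Variables (R : realType) (p : nat).
Implicit Types (T L : 'M[R]_p) (A E : 'M[R[i]]_p).

Lemma subgenerator_opbound T : subgenerator T ->
  \forall k \near \oo, opbound (1 + k.+1%:R^-1 *: toCmx T) 1.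
Proof.
(* [c] dominates every [|T i i|], so one threshold on [k] makes the diagonal of [1 + T / k.+1]
   nonnegative in all rows. *)
move=> [Toff Tdiag Trow]; pose c := \sum_i `|T i i|.
near=> k.
have k0 : 0 < k.+1%:R^-1 :> R by rewrite invr_gt0.
have ck : c <= k.+1%:R.
  have : (Num.truncn c <= k)%N by near: k; exact: nbhs_infty_ge.
  by move=> h; apply: ltW; rewrite (lt_le_trans (truncnS_gt _))// ler_nat.
have PE i j : (1 + k.+1%:R^-1 *: toCmx T) i j =
    real_complex R ((i == j)%:R + k.+1%:R^-1 * T i j).
  by rewrite !mxE rmorphD rmorphM fmorphV !rmorph_nat.
have P0 i j : 0 <= (i == j)%:R + k.+1%:R^-1 * T i j.
  have [<-|ij] := eqVneq i j; last by rewrite add0r mulr_ge0 ?Toff ?(ltW k0).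
  rewrite -[1%:R](@mulVf _ k.+1%:R) ?pnatr_eq0// -mulrDr mulr_ge0 ?(ltW k0)//.
  rewrite -[T i i]opprK subr_ge0 (le_trans _ ck)//.
  rewrite -(ltr0_norm (Tdiag i)) /c (bigD1 i)//= lerDl.
  by apply: sumr_ge0.
apply: opbound_rows => // i.
under eq_bigr do rewrite PE modC_real ger0_norm//.
rewrite big_split /= -mulr_sumr (bigD1 i)//= eqxx big1 => [|j /negPf]; last first.
  by rewrite eq_sym => ->.
by rewrite addr0 gerDl mulr_ge0_le0// ltW.
Unshelve. all: by end_near. Qed.

(** The power estimate with [f = e / k.+1] is at most [expR e - 1]. This bound is independent of [k]
    and so survives the limit. *)
Lemma opbound_expmx_perturbation A E (e : R) : 0 <= e ->
  (\forall k \near \oo, opbound (1 + k.+1%:R^-1 *: A) 1) -> opbound E e ->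
  opbound (expmx A - expmx (A + E)) (expR e - 1).
Proof.
move=> e0 A1 Ee; rewrite -opprB; apply: opboundN.
apply: opbound_lim (entrycvgB (entrycvg_euler (A + E)) (entrycvg_euler A)) _.
  by rewrite subr_ge0 -expR0 ler_expR.
apply: filterS A1 => k A1; rewrite /euler_mx scalerDr addrA.
have ek : 0 <= e / k.+1%:R by rewrite divr_ge0.
have Ek : opbound (k.+1%:R^-1 *: E) (e / k.+1%:R).
  rewrite mulrC -[X in X * _]modC_natV; exact: opboundZ.
apply: opboundW (opbound_subX k.+1 ek A1 Ek); rewrite lerD2r.
apply: (@le_trans _ _ (expR (e / k.+1%:R) ^+ k.+1)).
  by rewrite lerXn2r ?nnegrE ?expR_ge0 ?addr_ge0// expR_ge1Dx.
by rewrite -expRM_natl mulrC divfK// pnatr_eq0.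
Qed.

Lemma opbound_Re_expmx_perturbation T L (eps : R[i]) (l : R) :
  complex.Re eps = 0 -> 0 <= l ->
  (\forall k \near \oo, opbound (1 + k.+1%:R^-1 *: toCmx T) 1) ->
  opbound (toCmx L) l ->
  opbound (expmx (toCmx T) - toCmx (Remx (expmx (toCmx T + eps *: toCmx L))))
    (expR (modC eps ^+ 2 * l ^+ 2) - 1).
Proof.
move=> eps0 l0 T1 Ll; pose b := complex.Im eps.
have {eps0}-> : eps = Complex 0 b by rewrite -eps0 /b; case: (eps).
rewrite modC_imag -exprMn.
apply: opbound_lim (entrycvgB (entrycvg_euler (toCmx T))
  (entrycvg_Re (entrycvg_euler _))) _.
  by rewrite subr_ge0 -expR0 ler_expR sqr_ge0.
apply: filterS T1 => k T1; rewrite /euler_mx /=.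
(* [Q] is the base of the perturbed Euler product. As [T] and [L] are real, its real part is
   [1 + T / k.+1] and its imaginary part is [b L / k.+1]. *)
pose Q : 'M[R[i]]_p := 1 + k.+1%:R^-1 *: (toCmx T + Complex 0 b *: toCmx L).
rewrite -[X in Remx (X ^+ _)]/Q.
have QE i j : Q i j = Complex ((i == j)%:R + k.+1%:R^-1 * T i j)
    (k.+1%:R^-1 * b * L i j).
  rewrite (_ : Q i j = real_complex R ((i == j)%:R + k.+1%:R^-1 * T i j) +
    Complex 0 b * real_complex R (k.+1%:R^-1 * L i j)).
    apply/eqP; rewrite eq_complex /= !mul0r mulr0 subrr !add0r addr0 eqxx/=.
    by apply/eqP; ring.
  by rewrite !mxE rmorphD !rmorphM fmorphV !rmorph_nat; ring.
have ReQ : toCmx (Remx Q) = 1 + k.+1%:R^-1 *: toCmx T.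
  apply/matrixP => i j; rewrite mxE [Remx Q i j]mxE QE !mxE.
  by rewrite -[LHS]/(real_complex R _) rmorphD rmorphM fmorphV !rmorph_nat.
have ImQ : toCmx (Immx Q) = real_complex R (k.+1%:R^-1 * b) *: toCmx L.
  apply/matrixP => i j; rewrite mxE [Immx Q i j]mxE QE !mxE.
  by rewrite -[LHS]/(real_complex R _) rmorphM.
have f0 : 0 <= `|b| * l / k.+1%:R by rewrite !mulr_ge0// invr_ge0.
rewrite -ReQ.
(* With [f = |b| l / k.+1], the product [k.+1 f] in the bound of [opbound_ReX] does not depend on
   [k]. *)
have -> : `|b| * l = k.+1%:R * (`|b| * l / k.+1%:R).
  by rewrite [RHS]mulrC divfK// pnatr_eq0.
apply: opbound_ReX => //; first by rewrite ReQ.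
rewrite ImQ (_ : _ / _ = modC (real_complex R (k.+1%:R^-1 * b)) * l).
  exact: opboundZ.
by rewrite modC_real normrM ger0_norm ?invr_ge0//; ring.
Qed.

End exponential_perturbation.

(** * Application to block-circulant matrices *)

Lemma bcircE (R : realType) (m n : nat) (U : n.-tuple 'M[R]_m) (eps : R[i]) :
  bcirc eps U = toCmx (btoep U) + eps *: toCmx (blow U).
Proof.
apply/matrixP => i j; rewrite !mxE.
case: leqP => _; rewrite !mxE /= ?mulr0 ?addr0//.
by rewrite -[X in X + _]/(0 : R[i]) add0r.
Qed.

Theorem theorem10 (R : realType) (m n : nat) (U : n.-tuple 'M[R]_m)
    (eps : R[i]) (hU : subgenerator (btoep U)) :
  mxnorm_inf (expmx (toCmx (btoep U)) - expmx (bcirc eps U))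
    <= expR (modC eps * mxnorm_inf (toCmx (blow U))) - 1
  /\ (complex.Re eps = 0 ->
      mxnorm_inf (expmx (toCmx (btoep U))
                  - toCmx (Remx (expmx (bcirc eps U))))
        <= expR (modC eps ^+ 2 * mxnorm_inf (toCmx (blow U)) ^+ 2) - 1).
Proof.
have T1 := subgenerator_opbound hU.
have Ll := opbound_mxnorm (toCmx (blow U)).
have l0 := mxnorm_inf_ge0 (toCmx (blow U)).
have e0 : 0 <= modC eps * mxnorm_inf (toCmx (blow U)).
  by rewrite mulr_ge0 ?modC_ge0.
(* [mxnorm_inf_le] also asks for a nonnegative bound; the exponents are nonnegative, so [expR] is at
   least 1. *)
rewrite bcircE; split=> [|eps0]; apply: mxnorm_inf_le.
- by rewrite subr_ge0 -expR0 ler_expR.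
- by apply: opbound_expmx_perturbation => //; exact: opboundZ.
- by rewrite subr_ge0 -expR0 ler_expR mulr_ge0 ?sqr_ge0.
- exact: opbound_Re_expmx_perturbation.
Qed.
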